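(* (i) Let $\big(\frac{r_j}{s_j}\big)_{j\in\mathbb{Z}}$ be an $N$-periodic or $N$-antiperiodic positive walk on a Farey $n$-gon. Then there exists an $N$-periodic sequence of integers $(c_j)_{j\in\mathbb{Z}}$ such that both $(r_j)$ and $(s_j)$ satisfy the recurrence $V_{j+1}=c_jV_j-V_{j-1}$ for all $j$, and $M(c_1,\ldots,c_N)=\pm\mathrm{Id}$. (ii) Conversely, let $c_1,\ldots,c_N$ be positive integers with $M(c_1,\ldots,c_N)=\pm\mathrm{Id}$, extended $N$-periodically to $(c_i)_{i\in\mathbb{Z}}$. Define $(r_{-1},s_{-1})=(0,-1)$, $(r_0,s_0)=(1,0)$ and $r_i=c_ir_{i-1}-r_{i-2}$, $s_i=c_is_{i-1}-s_{i-2}$ for all $i$ (extended in both directions). Then $\big(\frac{r_i}{s_i}\big)_{i\in\mathbb{Z}}$ is an $N$-periodic or $N$-antiperiodic walk on some Farey $n$-gon with $n\le N$.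
   Context: $M(c_1,\ldots,c_N)=\prod_{i=1}^{N}\begin{pmatrix}c_i&-1\\1&0\end{pmatrix}$ (product from left to right). The Farey graph has vertex set $\mathbb{Q}\cup\{\infty\}$ ($\infty=\frac10$), two irreducible fractions $\frac{r'}{s'},\frac{r''}{s''}$ being joined by an edge iff $r's''-r''s'=\pm1$. A Farey $n$-gon is a sequence of vertices $(v_0,\ldots,v_{n-1})$, $v_0=\frac10$, $v_{n-1}=\frac01$, with $v_{i-1}>v_i$ and $v_{i-1},v_i$ joined by an edge for $i=1,\dots,n-1$. Points are considered in the twofold covering of the projective line: a fraction $\frac rs$ is the integer pair $(r,s)$ with $\gcd(r,s)=1$, and $\frac{r}{s}$ and $\frac{-r}{-s}$ are distinguished. Given a Farey $n$-gon and $N\ge n$, a sequence $\big(\frac{r_j}{s_j}\big)_{j\in\mathbb{Z}}$ whose terms are (signed representatives $\pm$ of) vertices of the $n$-gon is $N$-periodic if $(r_{j+N},s_{j+N})=(r_j,s_j)$ for all $j$, and $N$-antiperiodic if $(r_{j+N},s_{j+N})=(-r_j,-s_j)$ for all $j$. Such a sequence is a walk on the $n$-gon if $\frac{r_j}{s_j}$ and $\frac{r_{j+1}}{s_{j+1}}$ are joined by an edge of the Farey graph for all $j$, and a positive walk if in addition $r_js_{j+1}-s_jr_{j+1}>0$ for all $j$.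
   Formalization: Part (ii) fails for c=(1,1,2,1,2,1,1), whose walk visits -1, outside every Farey n-gon (vertices in [0,∞]); the formal (ii) gives a walk on a Farey n-gon after applying some A in SL_2(Z), with A the identity whenever no r_i/s_i is negative. *)

(* Defs.v *)
From mathcomp Require Import all_boot all_order all_algebra.
Set Implicit Arguments.
Unset Strict Implicit.
Unset Printing Implicit Defensive.
Import Order.TTheory GRing.Theory Num.Theory.
Local Open Scope ring_scope.

(* [None] is the point oo = 1/0. *)
Definition farey_vertex := option rat.

Definition vnum (u : farey_vertex) : int := if u is Some q then numq q else 1.
Definition vden (u : farey_vertex) : int := if u is Some q then denq q else 0.

Definition farey_edge (u w : farey_vertex) : Prop :=
  vnum u * vden w - vnum w * vden u = 1 \/
  vnum u * vden w - vnum w * vden u = - 1.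

Definition farey_gt (u w : farey_vertex) : bool :=
  match u, w with
  | None, Some _ => true
  | Some x, Some y => y < x
  | _, None => false
  end.

(* The condition on v_(n-1) excludes n = 0, as the default value is [None]. *)
Definition farey_ngon (n : nat) (v : n.-tuple farey_vertex) : Prop :=
  [/\ nth None v 0 = None,
      nth None v n.-1 = Some 0 &
      forall i : nat, (0 < i < n)%N ->
        farey_gt (nth None v i.-1) (nth None v i) /\
        farey_edge (nth None v i.-1) (nth None v i)].

(* The pair (r, s), seen as a point of the twofold covering of the projective
   line, is one of the two signed representatives of the vertex u. *)
Definition signed_rep (u : farey_vertex) (r s : int) : Prop :=
  (r, s) = (vnum u, vden u) \/ (r, s) = (- vnum u, - vden u).

Definition farey_walk (n : nat) (v : n.-tuple farey_vertex)
    (r s : int -> int) : Prop :=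
  (forall j : int, exists2 u, u \in (v : seq farey_vertex)
                            & signed_rep u (r j) (s j)) /\
  (forall j : int, forall u w : farey_vertex,
     signed_rep u (r j) (s j) -> signed_rep w (r (j + 1)) (s (j + 1)) ->
     farey_edge u w).

Definition positive_farey_walk (n : nat) (v : n.-tuple farey_vertex)
    (r s : int -> int) : Prop :=
  farey_walk v r s /\
  (forall j : int, 0 < r j * s (j + 1) - s j * r (j + 1)).

Definition periodic (N : nat) (r s : int -> int) : Prop :=
  forall j : int, r (j + N%:Z) = r j /\ s (j + N%:Z) = s j.

Definition antiperiodic (N : nat) (r s : int -> int) : Prop :=
  forall j : int, r (j + N%:Z) = - r j /\ s (j + N%:Z) = - s j.

Definition elem_mx (c : int) : 'M[int]_2 :=
  \matrix_(i < 2, j < 2)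
    if i == 0 then (if j == 0 then c else - 1)
    else (if j == 0 then 1 else 0).

(* M(c_1, ..., c_N), multiplied from left to right. *)
Definition Mmx (N : nat) (c : int -> int) : 'M[int]_2 :=
  \prod_(1 <= i < N.+1) elem_mx (c i%:Z).

(* A walk on the polygon v up to the action of SL_2(Z) on the Farey graph.  A
   closed positive walk starting at (0, -1), (1, 0) may leave [0, oo]: with
   (c_1, ..., c_7) = (1, 1, 2, 1, 2, 1, 1) it visits oo, 1, 0 and -1, which are
   not vertices of a polygon normalized by v_0 = 1/0 and v_(n-1) = 0/1.  The
   transformation must be trivial as soon as no point of the walk is negative. *)
Definition farey_walk_mod_SL2 (n : nat) (v : n.-tuple farey_vertex)
    (r s : int -> int) : Prop :=
  exists A : 'M[int]_2,
    [/\ \det A = 1,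
        (forall j : int, 0 <= r j * s j) -> A = 1%:M &
        farey_walk v (fun j => A 0 0 * r j + A 0 1 * s j)
                     (fun j => A 1 0 * r j + A 1 1 * s j)].

(* Main.v *)
(* Part (i): det(V_j, V_(j+1)) = 1 for all j forces
   V_(j+1) + V_(j-1) = c_j V_j with c_j = det(V_(j-1), V_(j+1)), and right
   multiplication by the elementary matrix of c_j sends the unimodular matrix
   with columns V_j, - V_(j-1) to the next one.

   Part (ii): the same matrices give the (anti)periodicity.  The polygon consists
   of the visited vertices; the point is that two cyclically consecutive visited
   vertices are joined by an edge.  A positive walk turns in one direction, and
   since c_j > 0 two successive steps make less than a full turn of the
   projective line.  Given a visited vertex x, let b be the first point met when
   turning from x among those that follow x in the walk.  Farey edges do not
   cross, so the walk can pass from one side of the chord xb to the other only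
   through x or b; from x it always goes to the far side or to b, and coming
   from the far side it cannot traverse b.  As the walk is closed, all of it lies
   on the far side, so b is the next visited vertex after x.  Applied to x = 0/1,
   this yields a unipotent matrix fixing 0 and moving b to 1/0, which brings the
   walk into [0, oo]. *)
Require Import Defs.
From mathcomp Require Import all_boot all_order all_algebra.
From mathcomp Require Import zify ring.
Set Implicit Arguments.
Unset Strict Implicit.
Unset Printing Implicit Defensive.
Import Order.TTheory GRing.Theory Num.Theory.
Local Open Scope ring_scope.

(** * Sequences indexed by the integers and confinement to a quadrant *)

Lemma int_ind2 (P : int -> Prop) : P 0 -> (forall i, P i -> P (i + 1)) ->
  (forall i, P i -> P (i - 1)) -> forall i, P i.
Proof.
move=> P0 PS PP; elim=> [|n IH|n IH] //.
  by rewrite intS addrC; apply: PS.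
by rewrite intS opprD addrC; apply: PP.
Qed.

Lemma periodic_mulz (T : Type) (N : nat) (f : int -> T) :
  (forall i, f (i + N%:Z) = f i) -> forall k i, f (i + k * N%:Z) = f i.
Proof.
move=> fN; elim/int_ind2 => [|k IH|k IH] i; first by congr f; lia.
  by rewrite -(IH i) -[RHS]fN; congr f; lia.
by rewrite -(IH i) -[LHS]fN; congr f; lia.
Qed.

(** Read [p i] and [q i] as coordinates of the walk in a unimodular basis. A step from [p * q > 0]
    to [p * q < 0] would make [p i * q (i + 1)] and [- q i * p (i + 1)] nonzero of equal sign, so
    their sum could not be 1. Only a vanishing coordinate lets the sign change. *)
Lemma quadrant_forward (c p q : int -> int) (j : int) :
  (forall i, 0 < c i) ->
  (forall i, p (i + 1) = c i * p i - p (i - 1)) ->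
  (forall i, q (i + 1) = c i * q i - q (i - 1)) ->
  (forall i, p i * q (i + 1) - q i * p (i + 1) = 1) ->
  (forall i, p i = 0 -> 0 <= p (i + 1) * q (i + 1)) ->
  p j = 0 -> forall n : nat, 0 <= p (j + n%:Z) * q (j + n%:Z).
Proof.
move=> c_gt0 pE qE det1 out0 pj0 n.
(* In the third case the walk is at oo, and [0 < c i] sends it back into the
   quadrant it comes from. *)
pose inv i := [\/ p i = 0, 0 < p i * q i |
                 q i = 0 /\ 0 <= p (i - 1) * q (i - 1)].
suff: inv (j + n%:Z) by case=> [->|/ltW //|[-> _]]; rewrite ?mul0r ?mulr0.
elim: n => [|n IH]; first by rewrite addr0; constructor 1.
have -> : j + n.+1%:Z = j + n%:Z + 1 by lia.
move: (j + n%:Z) IH => i IH; rewrite /inv addrK.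
have d1 := det1 i; have d0 := det1 (i - 1); rewrite subrK in d0.
have ci := c_gt0 i; have pe := pE i; have qe := qE i; have o0 := out0 i.
case: IH => [pi0|pq|[qi0 pq]].
- have {}o0 := o0 pi0.
  have [q0|qn] := eqVneq (q (i + 1)) 0.
    by constructor 3; rewrite pi0 mul0r.
  constructor 2; rewrite lt_def o0 andbT mulf_neq0 //.
  by apply/eqP => p0; move: d1; rewrite pi0 p0; lia.
- have [q0|qn] := eqVneq (q (i + 1)) 0; first by constructor 3; rewrite ltW.
  have [p0|pn] := eqVneq (p (i + 1)) 0; first by constructor 1.
  by constructor 2; clear - d1 pq qn pn; nia.
- constructor 2; rewrite pe qe qi0; move: d0; rewrite qi0 => d0.
  suff -> : (c i * p i - p (i - 1)) * (c i * 0 - q (i - 1)) =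
            c i * (p (i - 1) * 0 - q (i - 1) * p i) + p (i - 1) * q (i - 1).
    by rewrite d0; lia.
  ring.
Qed.

(** Even functions of the point do not see the sign of the antiperiodic case, so both kinds of
    closure become plain periodicity. *)
Lemma closed_mul (T : Type) (N : nat) (r s : int -> int) (f : int -> int -> T) :
  periodic N r s \/ antiperiodic N r s ->
  (forall a b, f (- a) (- b) = f a b) ->
  forall k i, f (r (i + k * N%:Z)) (s (i + k * N%:Z)) = f (r i) (s i).
Proof.
move=> rsN fN k i; apply: (periodic_mulz (f := fun i => f (r i) (s i))) => {k}i.
by case: rsN => /(_ i) [-> ->].
Qed.

Lemma quadrant_closed (N : nat) (c p q : int -> int) (j : int) :
  (0 < N)%N -> periodic N p q \/ antiperiodic N p q ->
  (forall i, 0 < c i) ->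
  (forall i, p (i + 1) = c i * p i - p (i - 1)) ->
  (forall i, q (i + 1) = c i * q i - q (i - 1)) ->
  (forall i, p i * q (i + 1) - q i * p (i + 1) = 1) ->
  (forall i, p i = 0 -> 0 <= p (i + 1) * q (i + 1)) ->
  p j = 0 -> forall i, 0 <= p i * q i.
Proof.
move=> N0 cl c0 pE qE d1 out0 pj0 i.
(* Adding [|i - j|] periods makes the offset nonnegative, as [N] is at least 1; the forward
   statement then reaches every index. *)
pose m := i - j + `|i - j| * N%:Z; have m0 : 0 <= m by rewrite /m; nia.
have := quadrant_forward c0 pE qE d1 out0 pj0 (absz m).
rewrite gez0_abs // /m addrA [j + _]addrC subrK.
by rewrite (closed_mul (f := fun a b => a * b) cl) // => a b; rewrite mulrNN.
Qed.

(** * Closed walks lie on one side of a chord *)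

Definition pdet (r s : int -> int) (i j : int) : int := r i * s j - s i * r j.

(** Unlike a walk on a given polygon, this notion is stable under SL_2(Z), so the walk can be moved
    before a polygon is chosen. *)
Record quiddity_walk (N : nat) (c r s : int -> int) : Prop := QuiddityWalk {
  qw_period_gt0 : (0 < N)%N;
  qw_coef_gt0 : forall i, 0 < c i;
  qw_num : forall i, r (i + 1) = c i * r i - r (i - 1);
  qw_den : forall i, s (i + 1) = c i * s i - s (i - 1);
  qw_det : forall i, pdet r s i (i + 1) = 1;
  qw_closed : periodic N r s \/ antiperiodic N r s }.

(* [k] is the visit to the vertex [V_j] whose successor comes first in the
   direction of the walk; in the basis [- V_k], [V_(k+1)] the walk stays in one
   closed quadrant, up to sign. *)
Lemma walk_one_side (N : nat) (c r s : int -> int) (j : int) :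
  quiddity_walk N c r s ->
  exists2 k, pdet r s j k = 0 &
    forall i, 0 <= pdet r s k i * pdet r s (k + 1) i.
Proof.
move=> [N0 c0 rE sE dE cl].
have N_neq0 : N%:Z != 0 by lia.
pose x0 := r j; pose y0 := s j; pose x1 := r (j + 1); pose y1 := s (j + 1).
(* If V_i = e V_j with e = 1 or -1, then V_(i+1) = e (V_(j+1) - g i V_j). *)
pose g (i : int) := (r i * y1 - s i * x1) * (x1 * s (i + 1) - y1 * r (i + 1)).
have gN k i : g (i + k * N%:Z) = g i.
  apply: (periodic_mulz (f := g)) => {k}i; rewrite /g.
  have -> : i + N%:Z + 1 = i + 1 + N%:Z by lia.
  by case: cl => cl; have [-> ->] := cl i; have [-> ->] := cl (i + 1); ring.
pose e (i : int) := pdet r s j i == 0.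
have eN k i : e (i + k * N%:Z) = e i.
  apply: (closed_mul (f := fun a b => r j * b - s j * a == 0)) => // a b.
  by lia.
have modN_lt i : (`|(i %% N%:Z)%Z| < N)%N.
  have := modz_ge0 i N_neq0; have := ltz_pmod i (_ : 0 < N%:Z); lia.
pose o i := Ordinal (modN_lt i).
have oE i : (o i : nat)%:Z = i + - (i %/ N%:Z)%Z * N%:Z.
  rewrite /= gez0_abs ?modz_ge0 //; have := divz_eq i N%:Z; lia.
have eo i : e (o i : nat)%:Z = e i by rewrite oE eN.
have go i : g (o i : nat)%:Z = g i by rewrite oE gN.
have ej : e (o j : nat)%:Z by rewrite eo /e /pdet; apply/eqP; ring.
(* Since [e] and [g] are [N]-periodic, minimizing over residues modulo [N] minimizes over all visits
   to the vertex. *)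
case: (@arg_minP _ _ _ _ (fun i : 'I_N => e (i : nat)%:Z)
                 (fun i : 'I_N => g (i : nat)%:Z) ej) => k0 ek0 kmin.
pose k : int := (k0 : nat)%:Z; have ek : pdet r s j k = 0 by apply/eqP.
have {}kmin i : pdet r s j i = 0 -> g k <= g i.
  by move=> ei; rewrite -(go i); apply: kmin; rewrite eo /e ei.
have dj : x0 * y1 - y0 * x1 = 1 by exact: dE.
pose eps i := r i * y1 - s i * x1.
have visit l : pdet r s j l = 0 ->
    [/\ eps l * eps l = 1, r l = eps l * x0, s l = eps l * y0,
        r (l + 1) = eps l * (x1 - g l * x0) &
        s (l + 1) = eps l * (y1 - g l * y0)].
  rewrite /pdet -/x0 -/y0 => ei; have di := dE l; rewrite /pdet in di.
  have rE' : r l = eps l * x0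
    by rewrite -[LHS]mulr1 -dj -[LHS]subr0 -(mulr0 x1) -ei /eps; ring.
  have sE' : s l = eps l * y0
    by rewrite -[LHS]mulr1 -dj -[LHS]subr0 -(mulr0 y1) -ei /eps; ring.
  have e1 : eps l * (x0 * s (l + 1) - y0 * r (l + 1)) = 1.
    by rewrite -[RHS]di rE' sE'; ring.
  have e2 : eps l * eps l = 1.
    by rewrite mulrC in e1; exact: intUnitRing.mulVz (intUnitRing.unitzPl e1).
  have e3 : x0 * s (l + 1) - y0 * r (l + 1) = eps l.
    by rewrite -[LHS]mul1r -{1}e2 -mulrA e1 mulr1.
  have ge : eps l * g l = x1 * s (l + 1) - y1 * r (l + 1).
    by rewrite /g -/(eps l) mulrA e2 mul1r.
  by split=> //; rewrite mulrBr mulrA ge -e3 -[LHS]mul1r -{1}dj; ring.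
exists k => //; have [ek2 rk sk rk1 sk1] := visit k ek.
apply: (@quadrant_closed N c _ _ k) => //.
- rewrite /periodic /antiperiodic /pdet; case: cl => cl; [left|right] => i;
    by have [-> ->] := cl i; split; ring.
- by move=> i; rewrite /pdet rE sE; ring.
- by move=> i; rewrite /pdet rE sE; ring.
- move=> i; transitivity (pdet r s k (k + 1) * pdet r s i (i + 1)).
    by rewrite /pdet; ring.
  by rewrite !dE.
(* When the walk leaves the vertex again, the product of its coordinates is [g i - g k], nonnegative
   by minimality. *)
- move=> i; rewrite {1}/pdet rk sk => di.
  have {di}ei : pdet r s j i = 0.
    rewrite -[LHS]mul1r -ek2 -mulrA /pdet -/x0 -/y0 -[RHS](mulr0 (eps k)) -di.
    by ring.
  have [ei2 ri si ri1 si1] := visit i ei.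
  have -> : pdet r s k (i + 1) = eps k * eps i.
    by rewrite /pdet rk sk ri1 si1 -[RHS]mulr1 -dj; ring.
  have -> : pdet r s (k + 1) (i + 1) = eps k * eps i * (g i - g k).
    by rewrite /pdet rk1 sk1 ri1 si1 -[RHS]mulr1 -dj; ring.
  have -> : eps k * eps i * (eps k * eps i * (g i - g k)) =
            eps k * eps k * (eps i * eps i) * (g i - g k) by ring.
  by rewrite ek2 ei2 !mul1r subr_ge0 kmin.
- by rewrite /pdet; ring.
Qed.

(** * Vertices, signed representatives and their order *)

Definition vertex (a b : int) : farey_vertex :=
  if b == 0 then None else Some (a%:~R / b%:~R).

Lemma vertexN a b : vertex (- a) (- b) = vertex a b.
Proof.
by rewrite /vertex oppr_eq0 !rmorphN /= invrN mulrNN.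
Qed.

Lemma signed_rep_vertex a b : coprimez a b -> signed_rep (vertex a b) a b.
Proof.
rewrite coprimezE /signed_rep /vertex; have [->|b0] := eqVneq b 0.
  rewrite /coprime gcdn0 => /eqP a1; have [->|->] : a = 1 \/ a = - 1 by lia.
    by left.
  by right.
move=> ab; rewrite /= coprimeq_num // coprimeq_den // (negbTE b0).
case: (sgzP b) b0 => // b0 _; rewrite ?gtr0_sg ?ltr0_sg ?mul1r ?mulN1r //;
  by [left; congr pair; lia|right; congr pair; lia].
Qed.

(** Denominators are nonnegative and oo is 1/0, so cross-multiplication also covers oo. Order and
    edges are then read off the same determinant. *)
Lemma farey_gtE u w : farey_gt u w = (0 < vnum u * vden w - vnum w * vden u).
Proof.
case: u w => [x|] [y|] /=.
- by rewrite subr_gt0; exact: lt_ratE.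
- by rewrite mulr0 mul1r sub0r oppr_gt0 ltNge denq_ge0.
- by rewrite mulr0 mul1r subr0 denq_gt0.
- by rewrite subrr ltxx.
Qed.

Lemma farey_gt_trans : transitive farey_gt.
Proof.
by move=> [y|] [x|] [z|] //= xy yz; apply: lt_trans yz xy.
Qed.

Lemma farey_gt_total u w : [|| u == w, farey_gt u w | farey_gt w u].
Proof.
case: u w => [x|] [y|] //=; rewrite -[Some x == Some y]/(x == y).
by case: ltgtP.
Qed.

Definition farey_ge u w := (u == w) || farey_gt u w.

Lemma farey_ge_trans : transitive farey_ge.
Proof.
move=> y x z /orP[/eqP -> //|xy] /orP[/eqP <-|yz]; apply/orP; right=> //.
exact: farey_gt_trans yz.
Qed.

Lemma farey_ge_total : total farey_ge.
Proof.
move=> x y; rewrite /farey_ge.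
by case/or3P: (farey_gt_total x y) => ->; rewrite ?orbT.
Qed.

Lemma farey_gt_asym u w : farey_gt u w -> farey_gt w u = false.
Proof. by rewrite !farey_gtE; lia. Qed.

Lemma farey_det0 u w : vnum u * vden w - vnum w * vden u = 0 -> u = w.
Proof.
move=> d0; case/or3P: (farey_gt_total u w) => [/eqP //||]; rewrite farey_gtE.
  by rewrite d0.
lia.
Qed.

Lemma signed_rep_sign u a b : signed_rep u a b ->
  exists2 e, e = 1 \/ e = - 1 & a = e * vnum u /\ b = e * vden u.
Proof.
by case=> -[-> ->]; [exists 1|exists (-1)]; rewrite ?mul1r ?mulN1r; auto.
Qed.

Lemma vden_ge0 u : 0 <= vden u.
Proof. by case: u => [x|] //=; rewrite denq_ge0. Qed.

Lemma signed_rep_ge0 u a b : signed_rep u a b -> 0 <= a * b -> 0 <= vnum u.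
Proof.
have := vden_ge0 u; have : vden u = 0 -> vnum u = 1.
  by case: u => //= x /eqP; rewrite denq_eq0.
by move=> u0 d0 /signed_rep_sign [e [] -> [-> ->]]; nia.
Qed.

(** * The polygon of visited vertices *)

Lemma quiddity_walk_coprime N c r s i :
  quiddity_walk N c r s -> coprimez (r i) (s i).
Proof.
move=> /qw_det /(_ i) d1; apply/coprimezP.
exists (s (i + 1), - r (i + 1)) => /=.
by rewrite -[RHS]d1 /pdet; ring.
Qed.

Lemma mem_visited (N : nat) (r s : int -> int) (i : int) :
  (0 < N)%N -> periodic N r s \/ antiperiodic N r s ->
  vertex (r i) (s i) \in [seq vertex (r j%:Z) (s j%:Z) | j <- iota 0 N].
Proof.
move=> N0 cl; have NZ : N%:Z != 0 by lia.
apply/mapP; exists (absz (i %% N%:Z)%Z).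
  rewrite mem_iota add0n /=.
  by have := ltz_pmod i (_ : 0 < N%:Z); have := modz_ge0 i NZ; lia.
rewrite gez0_abs ?modz_ge0 // {1 2}(divz_eq i N%:Z) addrC.
exact: (closed_mul (f := vertex) cl vertexN).
Qed.

Lemma positive_walk_on_polygon N c r s :
  quiddity_walk N c r s -> (forall i, 0 <= r i * s i) ->
  (exists i, r i = 0) -> (exists i, s i = 0) ->
  exists (n : nat) (v : n.-tuple farey_vertex),
    [/\ (n <= N)%N, farey_ngon v & farey_walk v r s].
Proof.
move=> W rs0 [i0 ri0] [i1 si1]; have [N0 c0 rE sE dE cl] := W.
pose V i := vertex (r i) (s i).
have rep i : signed_rep (V i) (r i) (s i).
  exact/signed_rep_vertex/(quiddity_walk_coprime i W).
have VE i j : pdet r s i j = 0 -> V i = V j.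
  move=> dij; apply: farey_det0; move: dij.
  have [e [] -> [re se]] := signed_rep_sign (rep i);
    have [e' [] -> [re' se']] := signed_rep_sign (rep j);
    by rewrite /pdet re se re' se'; lia.
pose vs := sort farey_ge (undup [seq V j%:Z | j <- iota 0 N]).
have Vvs i : V i \in vs by rewrite mem_sort mem_undup; apply: mem_visited.
have vsV u : u \in vs -> exists i, u = V i.
  by rewrite mem_sort mem_undup => /mapP[j _ ->]; exists j%:Z.
have vs_num u : u \in vs -> 0 <= vnum u.
  by move=> /vsV[i ->]; apply: signed_rep_ge0 (rep i) (rs0 i).
have V0 : V i0 = Some 0.
  apply: farey_det0; have [e eE [re _]] := signed_rep_sign (rep i0).
  by rewrite /= mul0r subr0 mulr1; case: eE re => ->; lia.
have Voo : V i1 = None by rewrite /V si1.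
have vs_uniq : uniq vs by rewrite sort_uniq undup_uniq.
have vs_sorted : sorted farey_ge vs by apply: sort_sorted farey_ge_total _.
have nthP i j : (i <= j)%N -> (j < size vs)%N ->
    farey_ge (nth None vs i) (nth None vs j).
  move=> ij jn; apply: (sorted_leq_nth farey_ge_trans) => //.
    by move=> x; rewrite /farey_ge eqxx.
  exact: leq_ltn_trans jn.
have vs_gt0 : (0 < size vs)%N by case: (vs) (Vvs 0).
have idx u : u \in vs ->
    nth None vs (index u vs) = u /\ (index u vs < size vs)%N.
  by move=> uvs; rewrite nth_index // index_mem.
exists (size vs), (in_tuple vs); split.
- by rewrite size_sort (leq_trans (size_undup _)) // size_map size_iota.
- split=> /=.
  + have [nI lt] := idx _ (Vvs i1); have := nthP 0 _ isT lt.
    by rewrite nI Voo /farey_ge; case: nth => // ? /orP[].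
  + have ltn1 : ((size vs).-1 < size vs)%N by rewrite ltn_predL.
    have [nI lt] := idx _ (Vvs i0).
    have := nthP (index (V i0) vs) (size vs).-1 _ ltn1.
    rewrite nI V0 => /(_ _)/orP[|/eqP <- //|].
      by rewrite V0 in lt *; lia.
    rewrite farey_gtE /= mul0r mulr1 sub0r oppr_gt0 ltNge.
    by rewrite (vs_num _ (mem_nth None ltn1)).
  + move=> i /andP[i_gt0 i_lt].
    have i1_lt : (i.-1 < size vs)%N := leq_ltn_trans (leq_pred _) i_lt.
    set x := nth None vs i.-1; set y := nth None vs i.
    have xvs : x \in vs by apply: mem_nth.
    have yvs : y \in vs by apply: mem_nth.
    have gt_xy : farey_gt x y.
      have := nthP i.-1 i (leq_pred _) i_lt; rewrite /farey_ge nth_uniq //.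
      by have -> : (i.-1 == i) = false by lia.
    split=> //; have [j xj] := vsV _ xvs.
    have [k djk side] := walk_one_side j W.
    pose b := V (k + 1).
    have [e eE [rk sk]] := signed_rep_sign (rep k).
    have [e' eE' [rk1 sk1]] := signed_rep_sign (rep (k + 1)).
    rewrite -(VE _ _ djk) -xj in rk sk; rewrite -/b in rk1 sk1.
    have dxb := dE k; rewrite /pdet rk sk rk1 sk1 in dxb.
    (* The sign of the representative of [u] cancels; those of [x] and [b] survive as [e * e']. *)
    have sideV u : u \in vs ->
        0 <= e * e' * ((vnum x * vden u - vnum u * vden x) *
                       (vnum b * vden u - vnum u * vden b)).
      move=> /vsV[l ->]; have := side l.
      have [e2 eE2 [rl sl]] := signed_rep_sign (rep l).
      rewrite /pdet rk sk rk1 sk1 rl sl.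
      by case: eE2 => ->; congr is_true; congr (_ <= _); ring.
    have x_num : 0 < vnum x.
      move: gt_xy; rewrite farey_gtE.
      have := vs_num _ yvs; have := vs_num _ xvs; have := vden_ge0 x.
      have := vden_ge0 y; nia.
    have bvs : b \in vs by apply: Vvs.
    (* With the other sign, the visit to 0/1 would force b = 0/1. *)
    have ee1 : e * e' = 1.
      have := sideV (Some 0); rewrite -V0 Vvs V0 => /(_ isT) /=.
      rewrite !mul0r !mulr1 !subr0; have := vs_num _ bvs => b0 s0.
      have : e * e' = 1 \/ e * e' = - 1 by case: eE eE' => -> [] ->; auto.
      case=> // ee; rewrite ee in s0.
      have b00 : vnum b = 0 by nia.
      have : e * e' * (vnum x * vden b) = 1 by rewrite -dxb b00; ring.
      by rewrite ee; have := vden_ge0 b; nia.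
    have edge_xb : vnum x * vden b - vnum b * vden x = 1.
      by rewrite -[RHS]dxb -[LHS]mul1r -ee1; ring.
    left; suff -> : y = b by [].
    have gt_xb : farey_gt x b by rewrite farey_gtE edge_xb.
    have [nI lt] := idx b bvs.
    have le_i : (i <= index b vs)%N.
      rewrite leqNgt; apply/negP => lt_i.
      have := nthP (index b vs) i.-1 _ i1_lt; rewrite nI -/x /farey_ge.
      rewrite (farey_gt_asym gt_xb) orbF => /(_ _)/eqP bx.
      by move: gt_xb; rewrite bx ?farey_gtE; lia.
    (* Hence [y] is at least [b]. If it lay strictly between [x] and [b], the two determinants in
       [sideV] would have opposite signs. *)
    have := nthP _ _ le_i lt; rewrite nI -/y => /orP[/eqP //|gt_yb].
    have := sideV y yvs; rewrite ee1 mul1r.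
    by move: gt_xy gt_yb; rewrite !farey_gtE; nia.
- split=> j; first by exists (V j); [exact: Vvs|exact: rep].
  move=> u w /signed_rep_sign[e eE [ru su]] /signed_rep_sign[e' eE' [rw sw]].
  have := dE j; rewrite /pdet ru su rw sw /farey_edge.
  by case: eE eE' => -> [] ->; lia.
Qed.

(** * Unimodular frames and the recurrence *)

Definition frame (r s : int -> int) (j : int) : 'M[int]_2 :=
  \matrix_(a < 2, b < 2)
    if a == 0 then (if b == 0 then r j else - r (j - 1))
    else (if b == 0 then s j else - s (j - 1)).

Lemma mx2P (A B : 'M[int]_2) : A 0 0 = B 0 0 -> A 0 1 = B 0 1 ->
  A 1 0 = B 1 0 -> A 1 1 = B 1 1 -> A = B.
Proof.
move=> e00 e01 e10 e11; apply/matrixP => i j.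
have ord2 (k : 'I_2) : k = 0 \/ k = 1.
  by case: k => [[|[|k]] lt] //; [left|right]; apply: val_inj.
by case: (ord2 i) => ->; case: (ord2 j) => ->.
Qed.

(** One step is [frame r s j * elem_mx (c j) = frame r s (j + 1)]; the product begins with c_1,
    hence the initial frame at 1. *)
Lemma frame_Mmx (c r s : int -> int) (N : nat) :
  (forall j, r (j + 1) = c j * r j - r (j - 1)) ->
  (forall j, s (j + 1) = c j * s j - s (j - 1)) ->
  frame r s 1 * Mmx N c = frame r s (N%:Z + 1).
Proof.
move=> rE sE; elim: N => [|N IH].
  by rewrite /Mmx big_geq // mulr1 add0r.
rewrite /Mmx big_nat_recr //= mulrA -/(Mmx N c) IH.
have -> : N%:Z + 1 = N.+1%:Z by lia.
apply: mx2P; rewrite mxE !big_ord_recl big_ord0 !mxE /= ?addrK ?rE ?sE; ring.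
Qed.

Lemma det_mx2 (A : 'M[int]_2) : \det A = A 0 0 * A 1 1 - A 0 1 * A 1 0.
Proof.
rewrite (expand_det_row _ 0) !big_ord_recl big_ord0 /cofactor !det_mx11 !mxE /=.
have -> : lift 0 0 = 1 :> 'I_2 by apply: val_inj.
have -> : lift 1 0 = 0 :> 'I_2 by apply: val_inj.
by ring.
Qed.

Lemma frame_inj (r s : int -> int) (j : int) (A B : 'M[int]_2) :
  pdet r s (j - 1) j = 1 -> frame r s j * A = frame r s j * B -> A = B.
Proof.
move=> d1; have u : frame r s j \in unitmx.
  rewrite unitmxE det_mx2 !mxE /=; set d := _ - _.
  suff -> : d = 1 by rewrite unitr1.
  by rewrite -d1 /d /pdet; ring.
by move=> /(congr1 (mulmx (invmx (frame r s j)))); rewrite !mulKmx.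
Qed.

(** The oldest term has coefficient -1, a unit, so the recurrence also runs backwards. *)
Lemma recurrence_unique (c x y : int -> int) :
  (forall j, x (j + 1) = c j * x j - x (j - 1)) ->
  (forall j, y (j + 1) = c j * y j - y (j - 1)) ->
  x 0 = y 0 -> x 1 = y 1 -> forall j, x j = y j.
Proof.
move=> xE yE e0 e1 j.
suff [] : x j = y j /\ x (j + 1) = y (j + 1) by [].
elim/int_ind2: j => [|j [ej ej1]|j [ej ej1]]; first by [].
  by split=> //; rewrite xE yE addrK ej ej1.
rewrite subrK; split=> //.
by rewrite -[LHS](subKr (c j * x j)) -xE -[RHS](subKr (c j * y j)) -yE ej ej1.
Qed.

Lemma quiddity_walk_SL2 (N : nat) (c r s : int -> int) (A : 'M[int]_2) :
  \det A = 1 -> quiddity_walk N c r s ->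
  quiddity_walk N c (fun j => A 0 0 * r j + A 0 1 * s j)
                    (fun j => A 1 0 * r j + A 1 1 * s j).
Proof.
rewrite det_mx2 => A1 [N0 c0 rE sE dE cl]; split=> // [i|i|i|].
- by rewrite rE sE; ring.
- by rewrite rE sE; ring.
- transitivity ((A 0 0 * A 1 1 - A 0 1 * A 1 0) * pdet r s i (i + 1)).
    by rewrite /pdet; ring.
  by rewrite A1 dE mulr1.
- by case: cl => cl; [left|right] => i; have [-> ->] := cl i; split; ring.
Qed.

(** * From positive walks to matrices and back *)

Lemma positive_walk_quiddity n N (v : n.-tuple farey_vertex) r s :
  positive_farey_walk v r s -> periodic N r s \/ antiperiodic N r s ->
  exists c : int -> int,
    [/\ forall j : int, c (j + N%:Z) = c j,
        forall j : int, r (j + 1) = c j * r j - r (j - 1),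
        forall j : int, s (j + 1) = c j * s j - s (j - 1) &
        Mmx N c = 1%:M \/ Mmx N c = - 1%:M].
Proof.
move=> [[vis edge] pos] cl.
have dE j : pdet r s j (j + 1) = 1.
  have [u _ ru] := vis j; have [w _ rw] := vis (j + 1).
  have := edge j u w ru rw; have := pos j; rewrite /pdet.
  move: ru rw => /signed_rep_sign[e eE [-> ->]].
  move=> /signed_rep_sign[e' eE' [-> ->]].
  by rewrite /farey_edge; case: eE eE' => -> [] ->; lia.
have dE' j : pdet r s (j - 1) j = 1 by have := dE (j - 1); rewrite subrK.
pose c j := pdet r s (j - 1) (j + 1).
have rE j : r (j + 1) = c j * r j - r (j - 1).
  have -> : r (j + 1) = pdet r s (j - 1) j * r (j + 1) by rewrite dE' mul1r.
  have -> : r (j - 1) = pdet r s j (j + 1) * r (j - 1) by rewrite dE mul1r.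
  by rewrite /c /pdet; ring.
have sE j : s (j + 1) = c j * s j - s (j - 1).
  have -> : s (j + 1) = pdet r s (j - 1) j * s (j + 1) by rewrite dE' mul1r.
  have -> : s (j - 1) = pdet r s j (j + 1) * s (j - 1) by rewrite dE mul1r.
  by rewrite /c /pdet; ring.
exists c; split=> // [j|].
  have e1 : j + N%:Z - 1 = j - 1 + N%:Z by lia.
  have e2 : j + N%:Z + 1 = j + 1 + N%:Z by lia.
  rewrite /c /pdet e1 e2.
  case: cl => cl; have [-> ->] := cl (j - 1); have [-> ->] := cl (j + 1);
    by ring.
have d1 : pdet r s (1 - 1) 1 = 1 by apply: dE'.
have M := frame_Mmx N rE sE; rewrite [N%:Z + 1]addrC in M.
(* Closure at 0 and 1 makes the final frame plus or minus the initial one, which can be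
   cancelled. *)
case: cl => cl; have [r0 s0] := cl 0; have [r1 s1] := cl 1; [left|right];
  apply: (frame_inj d1); rewrite M ?mulrN mulr1;
  by apply: mx2P; rewrite !mxE /= ?[1 + N%:Z - 1]addrAC ?subrr ?r0 ?s0 ?r1 ?s1.
Qed.

(** Here [c i] produces V_i, whereas in [quiddity_walk] the coefficient at [j] produces V_(j+1);
    hence the shifted coefficients. *)
Lemma quiddity_walk_of_Mmx (N : nat) (c r s : int -> int) :
  (0 < N)%N ->
  (forall i : nat, (1 <= i <= N)%N -> 0 < c i%:Z) ->
  (forall i : int, c (i + N%:Z) = c i) ->
  Mmx N c = 1%:M \/ Mmx N c = - 1%:M ->
  (r (- 1), s (- 1)) = (0, - 1) ->
  (r 0, s 0) = (1, 0) ->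
  (forall i : int, r i = c i * r (i - 1) - r (i - 2)) ->
  (forall i : int, s i = c i * s (i - 1) - s (i - 2)) ->
  quiddity_walk N (fun j => c (j + 1)) r s.
Proof.
move=> N0 c0 cN M [rm1 sm1] [r0 s0] rE sE; have NZ : N%:Z != 0 by lia.
have shift (x : int -> int) : (forall i, x i = c i * x (i - 1) - x (i - 2)) ->
    forall j, x (j + 1 - 1) = c j * x (j - 1) - x (j - 1 - 1).
  by move=> xE j; rewrite addrK xE -addrA -opprD.
have tail (x : int -> int) : (forall i, x i = c i * x (i - 1) - x (i - 2)) ->
    forall j, x (j + 1) = c (j + 1) * x j - x (j - 1).
  by move=> xE j; rewrite xE addrK -addrA.
(* As [c] is periodic, the translate of [x] by [N] and [e * x] obey one recurrence; agreement at -1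
   and 0 suffices. *)
have closedE (e : int) (x : int -> int) :
    (forall i, x i = c i * x (i - 1) - x (i - 2)) ->
    x N%:Z = e * x 0 -> x (N%:Z - 1) = e * x (- 1) ->
    forall j, x (j + N%:Z) = e * x j.
  move=> xE x0 x1 j; have xE' := shift x xE.
  have := @recurrence_unique c (fun j => x (j + N%:Z - 1))
                               (fun j => e * x (j - 1)).
  rewrite /= => /(_ _ _ _ _ (j + 1)).
  rewrite addrK [j + 1 + _]addrAC addrK; apply=> [i|i||].
  - have := xE' (i + N%:Z).
    by rewrite cN [i + N%:Z + 1]addrAC [i + N%:Z - 1]addrAC.
  - by rewrite xE' mulrBr mulrCA.
  - by rewrite add0r sub0r.
  - by rewrite subrr [1 + _]addrC addrK.
(* With both sequences delayed by one, the frame at 1 has columns V_0 and - V_(-1): it is the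
   identity, so the product is itself the frame at [N + 1]. *)
have := @frame_Mmx c (fun j => r (j - 1)) (fun j => s (j - 1)) N
                   (shift r rE) (shift s sE).
have -> : frame (fun j => r (j - 1)) (fun j => s (j - 1)) 1 = 1.
  by apply: mx2P; rewrite !mxE /= ?subrr ?sub0r ?r0 ?s0 ?rm1 ?sm1.
rewrite mul1r => MN.
split=> //.
(* Reducing [i] rather than [i + 1] puts [m.+1] in the range from 1 to [N], where positivity is
   assumed. *)
- move=> i; pose m := absz (i %% N%:Z)%Z.
  have mE : m%:Z = (i %% N%:Z)%Z by rewrite gez0_abs ?modz_ge0.
  have mN : (m < N)%N by have := ltz_pmod i (_ : 0 < N%:Z); lia.
  have -> : i + 1 = m.+1%:Z + (i %/ N%:Z)%Z * N%:Z.
    by rewrite intS mE {1}(divz_eq i N%:Z); ring.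
  by rewrite (periodic_mulz cN); apply: c0; rewrite ltnS mN.
- exact: tail.
- exact: tail.
- elim/int_ind2 => [|j IH|j IH].
  + rewrite /pdet add0r r0 s0 (tail s sE 0) (tail r rE 0) r0 s0 sub0r rm1 sm1.
    by ring.
  + rewrite -[RHS]IH /pdet (tail s sE (j + 1)) (tail r rE (j + 1)) addrK.
    by ring.
  + by rewrite -[RHS]IH /pdet (tail s sE j) (tail r rE j) subrK; ring.
- have Mentry a b := congr1 (fun A : 'M[int]_2 => A a b) MN.
  have := Mentry 0 0; have := Mentry 0 1.
  have := Mentry 1 0; have := Mentry 1 1.
  rewrite !mxE /= addrK => s1 sN r1 rN.
  case: M => ME; rewrite ME !mxE /= in s1 sN r1 rN; [left|right] => i.
    split; rewrite -[RHS]mul1r; apply: closedE => //;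
      by rewrite ?r0 ?s0 ?rm1 ?sm1; lia.
  split; rewrite -[RHS]mulN1r; apply: closedE => //;
    by rewrite ?r0 ?s0 ?rm1 ?sm1; lia.
Qed.

Lemma quiddity_walk_normalized N c r s :
  quiddity_walk N c r s ->
  (r (- 1), s (- 1)) = (0, - 1) -> (r 0, s 0) = (1, 0) ->
  exists (n : nat) (v : n.-tuple farey_vertex),
    [/\ (n <= N)%N, farey_ngon v & farey_walk_mod_SL2 v r s].
Proof.
move=> W [rm1 sm1] [r0 s0].
have [k dk side] := walk_one_side (- 1) W.
have rk : r k = 0 by move: dk; rewrite /pdet rm1 sm1; lia.
have d1 := qw_det W k; rewrite /pdet rk mul0r sub0r in d1.
(* V_(k+1) is a neighbour of 0/1, so its numerator is 1 or -1 and [t] is the integer s/r; the shear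
   [s - t * r] sends it to oo. *)
pose t := r (k + 1) * s (k + 1).
have rr : r (k + 1) * r (k + 1) = 1.
  by rewrite -mulNr in d1; exact: intUnitRing.mulVz (intUnitRing.unitzPl d1).
have sk : s k = - r (k + 1).
  by rewrite -[LHS]mulr1 -{1}rr mulrA -[s k * _]opprK d1 mulN1r.
have ge0 i : 0 <= r i * (s i - t * r i).
  have := side i; rewrite /pdet rk sk mul0r sub0r !mulNr opprK.
  have -> : r (k + 1) * r i * (r (k + 1) * s i - s (k + 1) * r i) =
            r i * (r (k + 1) * r (k + 1) * s i - t * r i) by rewrite /t; ring.
  by rewrite rr mul1r.
pose A : 'M[int]_2 := \matrix_(a < 2, b < 2)
  if a == 0 then (b == 0)%:R else if b == 0 then - t else 1.
have A00 : A 0 0 = 1 by rewrite mxE.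
have A01 : A 0 1 = 0 by rewrite mxE.
have A10 : A 1 0 = - t by rewrite mxE.
have A11 : A 1 1 = 1 by rewrite mxE.
have detA : \det A = 1 by rewrite det_mx2 A00 A01 A10 A11; ring.
have [i|||n [v [nN ngon walk]]] :=
  positive_walk_on_polygon (quiddity_walk_SL2 detA W).
- by rewrite A00 A01 A10 A11 mul1r mul0r addr0 mulNr addrC mul1r ge0.
- by exists k; rewrite A01 rk mulr0 mul0r addr0.
- exists (k + 1); rewrite A10 A11 /t mulNr -mulrA [s _ * _]mulrC mulrA rr.
  by rewrite !mul1r addNr.
- exists n, v; split=> //; exists A; split=> // rs0.
  (* The hypothesis at [k + 1] gives [t >= 0], while [ge0] at the starting point (1, 0) gives
     [t <= 0]. *)
  have t_ge0 : 0 <= t by apply: rs0.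
  have t0 : t = 0 by have := ge0 0; rewrite r0 s0; lia.
  by apply: mx2P; rewrite ?A00 ?A01 ?A10 ?A11 !mxE ?t0.
Qed.

Theorem theorem4p13 :
  (forall (n N : nat) (v : n.-tuple farey_vertex) (r s : int -> int),
     farey_ngon v -> (n <= N)%N ->
     positive_farey_walk v r s ->
     periodic N r s \/ antiperiodic N r s ->
     exists c : int -> int,
       [/\ forall j : int, c (j + N%:Z) = c j,
           forall j : int, r (j + 1) = c j * r j - r (j - 1),
           forall j : int, s (j + 1) = c j * s j - s (j - 1) &
           Mmx N c = 1%:M \/ Mmx N c = - 1%:M])
  /\
  (forall (N : nat) (c r s : int -> int),
     (0 < N)%N ->
     (forall i : nat, (1 <= i <= N)%N -> 0 < c i%:Z) ->
     (forall i : int, c (i + N%:Z) = c i) ->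
     Mmx N c = 1%:M \/ Mmx N c = - 1%:M ->
     (r (- 1), s (- 1)) = (0, - 1) ->
     (r 0, s 0) = (1, 0) ->
     (forall i : int, r i = c i * r (i - 1) - r (i - 2)) ->
     (forall i : int, s i = c i * s (i - 1) - s (i - 2)) ->
     (periodic N r s \/ antiperiodic N r s) /\
     exists (n : nat) (v : n.-tuple farey_vertex),
       [/\ (n <= N)%N, farey_ngon v & farey_walk_mod_SL2 v r s]).
Proof.
split=> [n N v r s _ _|N c r s N0 c0 cN M Vm1 V0 rE sE].
  exact: positive_walk_quiddity.
have W := quiddity_walk_of_Mmx N0 c0 cN M Vm1 V0 rE sE.
by split; [exact: qw_closed W|exact: quiddity_walk_normalized W Vm1 V0].
Qed.
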